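(* Let $m\ge 2$, let $u_1,\dots,u_m$ be admissible functions on $\mathbb{Z}^d$ with Schwarz rearrangements $u_i^*=R_{\mathbb{Z}^d}u_i$, let $G:\mathbb{R}_+^m\to\mathbb{R}_+$ be a (Borel measurable) supermodular function with $G(\mathbf{0})=0$, and let each $H_{ij}:\mathbb{R}_+\to\mathbb{R}_+$, $1\le i<j\le m$, be nonincreasing (and nonnegative). Then $$\sum_{x_1,\dots,x_m\in\mathbb{Z}^d}G(u_1(x_1),\dots,u_m(x_m))\prod_{1\le i<j\le m}H_{ij}(d(x_i,x_j))\le\sum_{x_1,\dots,x_m\in\mathbb{Z}^d}G(u_1^*(x_1),\dots,u_m^*(x_m))\prod_{1\le i<j\le m}H_{ij}(d(x_i,x_j)).$$
   Context: $\mathbb{R}_+=[0,\infty)$, $d\ge1$ is an integer, $e_i$ is the $i$-th standard unit vector, $\langle\cdot,\cdot\rangle$ the Euclidean inner product. On $\mathbb{Z}^d$, $d(x,y)=\sum_{i=1}^d|x^i-y^i|$ is the graph distance of the lattice graph. Sums of nonnegative terms take values in $[0,\infty]$. A Borel measurable $G:\mathbb{R}_+^m\to\mathbb{R}$ is supermodular if $G(y+se_i+te_j)+G(y)\ge G(y+se_i)+G(y+te_j)$ for all $s,t\ge0$, $y\in\mathbb{R}_+^m$, $i\ne j$ (here $e_i$ are the standard unit vectors of $\mathbb{R}^m$). Admissible functions: $u\in C_0^+(\mathbb{Z}^d)$ means $u:\mathbb{Z}^d\to\mathbb{R}_+$ with $\{u>t\}$ finite for all $t>0$ (similarly on $\mathbb{Z}$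 or $\mathbb{Z}+1/2$). One-dimensional rearrangement: for $w$ admissible on $\mathbb{Z}$ or on $\mathbb{Z}+1/2$ with $n$-th largest values $a_1\ge a_2\ge\cdots$ (with multiplicity), $R_{\mathbb{Z}}w(x)=a_{1-2x}$ if $x\le0$ and $R_{\mathbb{Z}}w(x)=a_{2x}$ if $x>0$. Rearrangement on $\mathbb{Z}^d$: let $\vec E=\{e_i,\frac{e_i+e_j}{2},\frac{e_i-e_j}{2}:1\le i<j\le d\}$ (all $e_i$, $1\le i\le d$, included). For $e\in\vec E$, partition $\mathbb{Z}^d$ into the classes of the relation ''$x-y$ is parallel to $e$''; on each class $V$ the map $x\mapsto\langle e,x\rangle$ is a bijection onto $\mathbb{Z}$ or $\mathbb{Z}+1/2$, and the one-step rearrangement $R_eu$ is defined by $(R_eu)|_V=R_{\mathbb{Z}}(u|_V)$ under this identification. Fix an enumeration of $\vec E$ (for $d=2$: $e_1,e_2,\frac{e_1+e_2}{2},\frac{e_1-e_2}{2}$); $R^ku$ is obtained from $u$ by applying successively the first $k$ of the operators $R_e$ in the sequence obtained by repeating this enumeration cyclically. The Schwarz rearrangement is $R_{\mathbb{Z}^d}u(x)=\lim_{k\to\infty}R^ku(x)$, $x\in\mathbb{Z}^d$ (the limit exists). *)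

(* Defs.v *)
From HB Require Import structures.
From mathcomp Require Import all_boot all_order all_algebra.
From mathcomp Require Import all_classical all_reals all_analysis.

Set Implicit Arguments.
Unset Strict Implicit.
Unset Printing Implicit Defensive.

Import Order.TTheory GRing.Theory Num.Theory.
Import numFieldNormedType.Exports.

Local Open Scope classical_set_scope.
Local Open Scope ring_scope.

(* Points of Z^d are integer row vectors; the directions have coordinates in
   {0, 1, 1/2, -1/2}, so directions and inner products are taken over rat. *)

Definition lattice_dist (d : nat) (x y : 'rV[int]_d) : nat :=
  (\sum_(i < d) `|(x 0 i - y 0 i)%R|)%N.

Definition inner (d : nat) (e : 'rV[rat]_d) (x : 'rV[int]_d) : rat :=
  \sum_(i < d) e 0 i * (x 0 i)%:~R.

Definition admissible (R : realType) (T : Type) (u : T -> R) : Prop :=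
  (forall x, 0 <= u x) /\ (forall t, 0 < t -> finite_set [set x | t < u x]).

(* [a] is the [n]-th largest value (n >= 1, with multiplicity) of [w] on [D]:
   fewer than [n] points of [D] have a value > a, at least [n] a value >= a. *)
Definition is_nth_largest (R : realType) (T : Type) (D : set T) (w : T -> R)
    (n : nat) (a : R) : Prop :=
  ~ (`I_n #<= [set x | D x /\ a < w x])%card /\
  (`I_n #<= [set x | D x /\ a <= w x])%card.

(* For w admissible on an infinite D and n >= 1 such a value exists and is
   unique, so that the default 0 is irrelevant. *)
Definition nth_largest (R : realType) (T : Type) (D : set T) (w : T -> R)
    (n : nat) : R :=
  xget 0 [set a | is_nth_largest D w n a].

(* For s in Z or Z + 1/2 the argument of Num.truncn is a positive integer. *)
Definition rank_index (s : rat) : nat :=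
  Num.truncn (if s <= 0 then 1 - 2 * s else 2 * s).

(* D stands for Z or Z + 1/2, seen as a subset of rat. *)
Definition rearr_line (R : realType) (D : set rat) (w : rat -> R) (s : rat) : R :=
  nth_largest D w (rank_index s).

Definition parallel_class (d : nat) (e : 'rV[rat]_d) (x : 'rV[int]_d) :
    set 'rV[int]_d :=
  [set y | exists c : rat, map_mx intr (y - x) = c *: e].

(* [inner e @` V] is Z or Z + 1/2 and [inner e] is injective on V; u|_V is
   transported along it by means of its inverse. *)
Definition rearr_step (R : realType) (d : nat) (e : 'rV[rat]_d)
    (u : 'rV[int]_d -> R) (x : 'rV[int]_d) : R :=
  let V := parallel_class e x in
  rearr_line (inner e @` V) (u \o 'pinv_(fun=> x) V (inner e)) (inner e x).

Definition unit_vec (d : nat) (i : 'I_d) : 'rV[rat]_d := delta_mx 0 i.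

Definition directions (d : nat) : set 'rV[rat]_d :=
  [set e | (exists i : 'I_d, e = unit_vec i) \/
    (exists i j : 'I_d, (i < j)%N /\
      (e = 2^-1 *: (unit_vec i + unit_vec j) \/
       e = 2^-1 *: (unit_vec i - unit_vec j)))].

Definition enumerates_directions (d : nat) (E : seq 'rV[rat]_d) : Prop :=
  uniq E /\ [set` E] = @directions d.

Fixpoint rearr_iter (R : realType) (d : nat) (E : seq 'rV[rat]_d) (k : nat)
    (u : 'rV[int]_d -> R) : 'rV[int]_d -> R :=
  if k is k'.+1 then rearr_step (nth 0 E (k' %% size E)) (rearr_iter E k' u)
  else u.

Definition schwarz (R : realType) (d : nat) (E : seq 'rV[rat]_d)
    (u : 'rV[int]_d -> R) (x : 'rV[int]_d) : R :=
  limn (fun k => rearr_iter E k u x).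

Definition orthant (R : realType) (m : nat) : set 'rV[R]_m :=
  [set y | forall i, 0 <= y 0 i].

(* A function on R_+^m is given by a function on R^m of which only the values
   on the orthant matter. *)
Definition borel_on_orthant (R : realType) (m : nat) (G : 'rV[R]_m -> R) : Prop :=
  measurable_fun (@orthant R m : set (g_sigma_algebraType (@open 'rV[R]_m))) G.

Definition supermodular (R : realType) (m : nat) (G : 'rV[R]_m -> R) : Prop :=
  forall (y : 'rV[R]_m) (i j : 'I_m) (s t : R),
    orthant y -> i != j -> 0 <= s -> 0 <= t ->
    G (y + s *: delta_mx 0 i) + G (y + t *: delta_mx 0 j) <=
    G (y + s *: delta_mx 0 i + t *: delta_mx 0 j) + G y.

Definition riesz_sum (R : realType) (d m : nat) (G : 'rV[R]_m -> R)
    (H : 'I_m -> 'I_m -> R -> R) (u : 'I_m -> 'rV[int]_d -> R) : \bar R :=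
  \esum_(x in [set: {ffun 'I_m -> 'rV[int]_d}])
    (G (\row_i u i (x i)) *
     \prod_(i < m) \prod_(j < m | (i < j)%N)
       H i j (lattice_dist (x i) (x j))%:R)%:E.

(* Main.v *)
Require Import Defs.
From HB Require Import structures.
From mathcomp Require Import all_boot all_order all_algebra.
From mathcomp Require Import zify ring lra.

(** The proof is by polarization.  A reflection [s] that preserves the lattice and
    has a wall orthogonal to a direction [e] polarizes a function [u]: of the two
    values at [x] and [s x] the larger one moves to the side that contains a fixed
    centre.

    A polarization, applied to all functions at once, does not decrease the Riesz
    sum ([riesz_sum_polarize]).  For a fixed tuple [x], reflecting any of its
    coordinates produces [2 ^ m] tuples.  On these the kernel depends only on which
    pairs of coordinates are reflected alike, with a larger factor for the pairs
    that are: it is the weight of a ferromagnetic Ising model.  A supermodular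
    function correlates best with such a weight when the values are sorted
    ([ferromagnetic_sum_le]).

    The one-step rearrangement along [e] of a function with finite support is a
    composite of finitely many polarizations ([exists_polarized],
    [rearr_step_polarized]).  Indeed every polarization that has an effect lowers
    the sum of the squared distances to the centre, weighted by the ranks of the
    values ([potential_polarize]); this is a natural number, so the process stops,
    and it stops at a function that decreases on each line with the distance to the
    level 1/4, which is the one-step rearrangement.  One centre serves all
    directions, so the same potential does not increase along the whole sequence of
    one-step rearrangements, which therefore becomes stationary
    ([rearr_iter_stable]).

    For general admissible functions, truncation below a level [t > 0] gives finite
    support and commutes with the rearrangements ([rearr_step_cutoff]).  A finite
    partial sum does not see a truncation at a low enough level, and removing the
    truncation from the limit functions does not decrease [G], because
    supermodularity and [G 0 = 0] give [G y >= G y'] whenever [y'] is [y] with some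
    coordinates replaced by 0 ([supermodular_restrict_le]). *)

Set Implicit Arguments.
Unset Strict Implicit.
Unset Printing Implicit Defensive.

Import Order.TTheory GRing.Theory Num.Theory.

Local Open Scope ring_scope.

(** * Supermodular set functions and ferromagnetic weights *)

Definition flip (I : finType) (S X : {set I}) : {set I} :=
  [set i | (i \in X) (+) (i \in S)].

Lemma in_flip (I : finType) (S X : {set I}) i :
  (i \in flip S X) = (i \in X) (+) (i \in S).
Proof. by rewrite inE. Qed.

Lemma flipK (I : finType) (S : {set I}) : involutive (flip S).
Proof. by move=> X; apply/setP => i; rewrite !inE -addbA addbb addbF. Qed.

Lemma flip0 (I : finType) (X : {set I}) : flip set0 X = X.
Proof. by apply/setP => i; rewrite !inE addbF. Qed.

Definition locally_supermodular (R : realDomainType) (I : finType)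
    (g : {set I} -> R) : Prop :=
  forall (X : {set I}) (i j : I), i != j -> i \notin X -> j \notin X ->
    g (i |: X) + g (j |: X) <= g (i |: (j |: X)) + g X.

(** Adding the elements of [B] one at a time telescopes the local inequality;
    elements already present in [W] contribute trivially. *)
Lemma supermodular_point (R : realDomainType) (I : finType) (g : {set I} -> R) :
  locally_supermodular g ->
  forall (i : I) (B W : {set I}), i \notin B ->
    g (i |: W) + g (B :|: W) <= g (i |: (B :|: W)) + g W.
Proof.
move=> gS i B W; move: {2}#|B| (leqnn #|B|) => n; elim: n B => [|n IHn] B.
  by rewrite leqn0 cards_eq0 => /eqP->; rewrite !set0U lexx.
case: (set_0Vmem B) => [->|[j jB]]; first by rewrite !set0U lexx.
rewrite (cardsD1 j) jB add1n ltnS => /IHn {}IHn iB.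
have iBj : i \notin B :\ j by rewrite !inE negb_and iB orbT.
have IH := IHn iBj.
have -> : B :|: W = j |: (B :\ j :|: W) by rewrite setUA setD1K.
set C := B :\ j :|: W in IH *.
have ij : i != j by apply: contraNneq iB => ->.
have [iC|iC] := boolP (i \in C).
  have eC : i |: C = C by apply/setUidPr; rewrite sub1set.
  by move: IH; rewrite [i |: (j |: C)]setUCA eC; lra.
have [jC|jC] := boolP (j \in C).
  by have -> : j |: C = C by apply/setUidPr; rewrite sub1set.
by have := gS _ _ _ ij iC jC; lra.
Qed.

Lemma supermodular_disjoint (R : realDomainType) (I : finType)
    (g : {set I} -> R) :
  locally_supermodular g ->
  forall A B W : {set I}, [disjoint A & B] ->
    g (A :|: W) + g (B :|: W) <= g (A :|: B :|: W) + g W.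
Proof.
move=> gS A B; move: {2}#|A| (leqnn #|A|) => n; elim: n A => [|n IHn] A.
  by rewrite leqn0 cards_eq0 => /eqP-> W _; rewrite !set0U addrC lexx.
case: (set_0Vmem A) => [->|[i iA]]; first by move=> _ W _; rewrite !set0U addrC lexx.
rewrite (cardsD1 i) iA add1n ltnS => leAi W AB.
have iB : i \notin B by rewrite (disjointFr AB).
have /(IHn _ leAi W) : [disjoint A :\ i & B] by apply: disjointWl AB; exact: subsetDl.
have := supermodular_point gS (A :\ i :|: W) iB.
have -> : A :|: W = i |: (A :\ i :|: W) by rewrite setUA setD1K.
have -> : A :|: B :|: W = i |: (A :\ i :|: B :|: W) by rewrite 2!setUA setD1K.
have -> : B :|: (A :\ i :|: W) = A :\ i :|: B :|: W by rewrite setUCA setUA.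
lra.
Qed.

(** The next lemmas concern the sets [X] that do not separate the two ends of
    any pair of [r], that is, the unions of connected components of [r]. *)
Section components.
Variables (R : realDomainType) (I : finType) (r : {set I * I}).

Definition compat (X : {set I}) :=
  [forall p, (p \in r) ==> ((p.1 \in X) == (p.2 \in X))].

Let linked := [rel i j | ((i, j) \in r) || ((j, i) \in r)].

Definition component (i : I) : {set I} := [set j | connect linked i j].

Lemma compat_component X i j :
  compat X -> j \in component i -> (j \in X) = (i \in X).
Proof.
move=> /forallP cX; rewrite inE => ij; apply/esym.
apply: (closed_connect _ ij) => k l /orP[] kl.
  by apply/eqP; have := cX (k, l); rewrite kl.
by apply/esym/eqP; have := cX (l, k); rewrite kl.
Qed.

Lemma compat_flip_component X i : compat X -> compat (flip (component i) X).
Proof.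
move=> /forallP cX; apply/forallP => -[k l]; apply/implyP => kl.
have := cX (k, l); rewrite kl !inE /= => /eqP ->.
suff -> : connect linked i k = connect linked i l by [].
by apply/idP/idP => h; apply: (connect_trans h); apply: connect1; rewrite /= kl ?orbT.
Qed.

Lemma sum_compat_flip (g : {set I} -> R) (i : I) :
  \sum_(X | compat X) g (flip (component i) X) = \sum_(X | compat X) g X.
Proof.
rewrite [RHS](reindex_inj (inv_inj (flipK (component i)))) /=.
apply: eq_bigl => X; apply/idP/idP; first exact: compat_flip_component.
by move=> /compat_flip_component - /(_ i); rewrite flipK.
Qed.

(** Flipping a component [C] permutes the compatible sets.  Each of them contains
    [C] or avoids it, so for the pair [X], [flip C X] supermodularity compares
    [C :&: S :|: W] and [C :\: S :|: W] with their union [C :|: W] and their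
    intersection [W], where [W] is the common part outside [C].  This removes
    the component [C] from [S], and induction on [#|S|] concludes. *)
Lemma sum_compat_flip_le (g : {set I} -> R) (S : {set I}) :
  locally_supermodular g ->
  \sum_(X | compat X) g (flip S X) <= \sum_(X | compat X) g X.
Proof.
move=> gS; move: {2}#|S| (leqnn #|S|) => n; elim: n S => [|n IHn] S.
  by rewrite leqn0 cards_eq0 => /eqP->; under eq_bigr do rewrite flip0.
case: (set_0Vmem S) => [->|[i iS]]; first by under eq_bigr do rewrite flip0.
(* Removing a whole component C from S can only increase the sum. *)
move=> Sn; pose C := component i; have iC : i \in C by rewrite inE.
apply: le_trans (_ : \sum_(X | compat X) g (flip (S :\: C) X) <= _); last first.
  apply: IHn; rewrite -ltnS; apply: leq_trans Sn; apply: proper_card.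
  apply/properP; split; first exact: subsetDl.
  by exists i => //; rewrite inE iC.
have twice (T : {set I}) : (\sum_(X | compat X) g (flip T X)) *+ 2 =
    \sum_(X | compat X) (g (flip T X) + g (flip T (flip C X))).
  by rewrite big_split /= [in RHS](sum_compat_flip (g \o flip T)) mulr2n.
rewrite -(@ler_pMn2r _ 2)// !twice; apply: ler_sum => X cX.
pose W := flip S X :\: C.
have dS : [disjoint C :&: S & C :\: S].
  by rewrite -setI_eq0; apply/eqP/setP => k; rewrite !inE; case: (k \in S); rewrite ?andbF.
have := supermodular_disjoint gS W dS.
have XC k : k \in C -> (k \in X) = (i \in X) by exact: compat_component.
rewrite setID.
have inW k : (k \in W) = (k \notin C) && ((k \in X) (+) (k \in S)).
  by rewrite in_setD in_flip.
have mem := (in_flip, in_setU, in_setI, in_setD, inW).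
(* Of the two members of each pair, one contains W and the elements of C on
   one side of S, the other W and the remaining elements of C. *)
have [iX|/negbTE iX] := boolP (i \in X).
  have [-> -> -> ->] : [/\ flip S X = C :\: S :|: W,
      flip S (flip C X) = C :&: S :|: W, flip (S :\: C) X = C :|: W &
      flip (S :\: C) (flip C X) = W].
    by split; apply/setP => k; rewrite !mem;
      case: (boolP (k \in C)) => [/XC->|_]; rewrite ?iX;
      case: (k \in S); case: (k \in X).
  by move=> ?; lra.
have [-> -> -> ->] : [/\ flip S X = C :&: S :|: W,
    flip S (flip C X) = C :\: S :|: W, flip (S :\: C) X = W &
    flip (S :\: C) (flip C X) = C :|: W].
  by split; apply/setP => k; rewrite !mem;
    case: (boolP (k \in C)) => [/XC->|_]; rewrite ?iX;
    case: (k \in S); case: (k \in X).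
by move=> ?; lra.
Qed.

End components.

(** Writing each factor as [B p + (A p - B p) * 1_{p is not separated}] and
    expanding the product turns the weight into a nonnegative combination of
    indicators of compatibility, one for each set [r] of pairs. *)
Lemma ferromagnetic_sum_le (R : realDomainType) (I : finType)
    (g : {set I} -> R) (A B : I * I -> R) (S : {set I}) :
  locally_supermodular g ->
  (forall p, 0 <= B p) -> (forall p, B p <= A p) ->
  \sum_X g (flip S X) * \prod_p (if (p.1 \in X) == (p.2 \in X) then A p else B p)
  <= \sum_X g X * \prod_p (if (p.1 \in X) == (p.2 \in X) then A p else B p).
Proof.
move=> gS B0 BA.
pose c (r : {set I * I}) := \prod_p (if p \in r then A p - B p else B p).
have c0 r : 0 <= c r.
  by apply: prodr_ge0 => p _; case: ifP => _ //; rewrite subr_ge0.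
have prodE (X : {set I}) :
    \prod_p (if (p.1 \in X) == (p.2 \in X) then A p else B p) =
    \sum_(r : {set I * I}) c r * (compat r X)%:R.
  transitivity (\prod_p ((A p - B p) * ((p.1 \in X) == (p.2 \in X))%:R + B p)).
    by apply: eq_bigr => p _; case: eqP => _;
      rewrite ?mulr1 ?mulr0 ?subrK ?add0r.
  rewrite bigA_distr; apply: eq_big => // r _.
  have [cX|] := boolP (compat r X).
    rewrite mulr1; apply: eq_bigr => p _; case: ifP => // pr.
    by have /forallP/(_ p) := cX; rewrite pr /= => ->; rewrite mulr1.
  rewrite negb_forall mulr0 => /existsP[p]; rewrite negb_imply => /andP[pr np].
  by rewrite (bigD1 p)//= pr (negbTE np) mulr0 mul0r.
have exch (f : {set I} -> R) : \sum_X f X * (\sum_r c r * (compat r X)%:R) =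
    \sum_r c r * \sum_(X | compat r X) f X.
  under eq_bigr do rewrite mulr_sumr.
  rewrite exchange_big; apply: eq_bigr => r _; rewrite mulr_sumr [RHS]big_mkcond.
  by apply: eq_bigr => X _; case: (compat r X); rewrite ?mulr1 ?mulr0// mulrC.
under eq_bigr do rewrite prodE.
under [in X in _ <= X]eq_bigr do rewrite prodE.
rewrite (exch (g \o flip S)) (exch g); apply: ler_sum => r _.
by apply: ler_wpM2l => //; exact: sum_compat_flip_le.
Qed.

From mathcomp Require Import all_classical all_reals all_analysis.
Import numFieldNormedType.Exports.

(** * The two-point inequality *)

(** Restricting [G] to the vertices of a box gives a set function; the vertex
    indexed by [X] takes the lower value exactly on [X]. *)
Lemma supermodular_box (R : realType) (m : nat) (G : 'rV[R]_m -> R)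
    (lo hi : 'I_m -> R) :
  supermodular G -> (forall i, 0 <= lo i) -> (forall i, lo i <= hi i) ->
  locally_supermodular
    (fun X : {set 'I_m} => G (\row_i if i \in X then lo i else hi i)).
Proof.
move=> Gs lo0 lohi X i j ij iX jX.
pose y : 'rV[R]_m := \row_k if k \in i |: (j |: X) then lo k else hi k.
have y0 : orthant y.
  by move=> k; rewrite mxE; case: ifP => _ //; exact: le_trans (lohi k).
have := Gs y i j (hi i - lo i) (hi j - lo j) y0 ij.
rewrite !subr_ge0 => /(_ (lohi i) (lohi j)).
have -> : y + (hi i - lo i) *: delta_mx 0 i =
    \row_k if k \in j |: X then lo k else hi k.
  apply/rowP => k; rewrite !mxE eqxx /= !in_setU1.
  have [->|] := eqVneq k i => /=; last by rewrite mulr0 addr0.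
  by rewrite mulr1 (negbTE ij) (negbTE iX) /= addrC subrK.
have -> : y + (hi j - lo j) *: delta_mx 0 j =
    \row_k if k \in i |: X then lo k else hi k.
  apply/rowP => k; rewrite !mxE eqxx /= !in_setU1.
  have [->|] := eqVneq k j => /=; last by rewrite mulr0 addr0.
  by rewrite mulr1 eq_sym (negbTE ij) (negbTE jX) /= addrC subrK.
have -> : \row_k (if k \in j |: X then lo k else hi k)
    + (hi j - lo j) *: delta_mx 0 j = \row_k if k \in X then lo k else hi k.
  apply/rowP => k; rewrite !mxE eqxx /= !in_setU1.
  have [->|] := eqVneq k j => /=; last by rewrite mulr0 addr0.
  by rewrite mulr1 (negbTE jX) /= addrC subrK.
by rewrite [X in X <= _ -> _]addrC [X in _ <= X -> _]addrC.
Qed.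

(** Supermodularity at the vertices of the box from 0 to [y] bounds the sum of
    [G] at the restrictions of [y] to [S] and to its complement by [G y + G 0].
    This replaces monotonicity of [G], which may fail. *)
Lemma supermodular_restrict_le (R : realType) (m : nat) (G : 'rV[R]_m -> R)
    (y : 'rV[R]_m) (S : {set 'I_m}) :
  supermodular G -> (forall z, orthant z -> 0 <= G z) -> G 0 = 0 ->
  orthant y -> G (\row_i if i \in S then y 0 i else 0) <= G y.
Proof.
move=> Gs G0 G00 y0.
have := supermodular_box Gs (fun=> lexx 0) y0 => /supermodular_disjoint gS.
have /(gS _ _ finset.set0) : [disjoint ~: S & S] by rewrite finset.disjoints_subset subxx.
rewrite !finset.setU0 finset.setUC finset.setUCr.
set a := G _; set b := G _; set c := G _; set e := G _.
have b0 : 0 <= b by apply: G0 => k; rewrite mxE; case: ifP.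
have c0 : c = 0.
  by rewrite -G00; congr G; apply/rowP => k; rewrite !mxE finset.in_setT.
have -> : G y = e by congr G; apply/rowP => k; rewrite !mxE finset.in_set0.
have -> : G (\row_i (if i \in S then y 0 i else 0)) = a.
  by congr G; apply/rowP => k; rewrite !mxE finset.in_setC; case: (k \in S).
lra.
Qed.

(** [psi] stands for the distance to a centre, which tells apart the two sides of
    the wall of the reflection [s]. *)
Definition polarize (R : realType) (T : Type) (psi : T -> nat) (s : T -> T)
    (u : T -> R) (x : T) : R :=
  if (psi x < psi (s x))%N then Num.max (u x) (u (s x))
  else Num.min (u x) (u (s x)).

Lemma polarize_ge0 (R : realType) (T : Type) (psi : T -> nat) (s : T -> T)
    (u : T -> R) :
  (forall x, 0 <= u x) -> forall x, 0 <= polarize psi s u x.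
Proof.
by move=> u0 x; rewrite /polarize; case: ifP => _; rewrite ?le_max ?le_min !u0.
Qed.

(** A reflection for which polarization makes sense: two points on the same
    closed side of the wall are at least as close as one of them and the mirror
    image of the other. *)
Definition folding (d : nat) (psi : 'rV[int]_d -> nat)
    (s : 'rV[int]_d -> 'rV[int]_d) : Prop :=
  [/\ involutive s, (forall x, psi (s x) = psi x -> s x = x),
    (forall x y, lattice_dist (s x) (s y) = lattice_dist x y) &
    (forall x y, psi x <= psi (s x) -> psi y <= psi (s y) ->
       lattice_dist x y <= lattice_dist x (s y))%N].

Definition riesz_kernel (R : realType) (d m : nat) (H : 'I_m -> 'I_m -> R -> R)
    (x : 'I_m -> 'rV[int]_d) : R :=
  \prod_(i < m) \prod_(j < m | (i < j)%N) H i j (lattice_dist (x i) (x j))%:R.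

Definition reflect_some (d m : nat) (s : 'rV[int]_d -> 'rV[int]_d)
    (X : {set 'I_m}) (x : {ffun 'I_m -> 'rV[int]_d}) :
    {ffun 'I_m -> 'rV[int]_d} :=
  [ffun i => if i \in X then s (x i) else x i].

Lemma reflect_someK (d m : nat) (s : 'rV[int]_d -> 'rV[int]_d) (X : {set 'I_m}) :
  involutive s -> involutive (reflect_some s X).
Proof. by move=> sK x; apply/ffunP => i; rewrite !ffunE; case: (i \in X). Qed.

Lemma ge0_sume_const (R : realType) (I : finType) (c : \bar R) :
  (0 <= c)%E -> (\sum_(i : I) c = #|I|%:R%:E * c)%E.
Proof.
move=> c0; rewrite big_const; elim: #|I| => [|n IHn] /=; first by rewrite mul0e.
by rewrite IHn -[in RHS]natr1 addrC EFinD ge0_muleDl ?lee_fin// mul1e.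
Qed.

(** The two-point inequality.  The group generated by the reflections of single
    coordinates [x i] acts on the tuples [x]; polarization acts on each orbit
    separately, and on one orbit the inequality is [ferromagnetic_sum_le]. *)
Section two_point.
Variables (R : realType) (d m : nat) (psi : 'rV[int]_d -> nat).
Variables (s : 'rV[int]_d -> 'rV[int]_d) (G : 'rV[R]_m -> R).
Variables (H : 'I_m -> 'I_m -> R -> R) (u : 'I_m -> 'rV[int]_d -> R).
Hypothesis s_fold : folding psi s.
Hypothesis G_ge0 : forall y, orthant y -> 0 <= G y.
Hypothesis G_super : supermodular G.
Hypothesis H_ge0 : forall i j : 'I_m, (i < j)%N -> forall r : R, 0 <= r -> 0 <= H i j r.
Hypothesis H_mono : forall i j : 'I_m, (i < j)%N ->
  forall r r' : R, 0 <= r -> r <= r' -> H i j r' <= H i j r.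
Hypothesis u_ge0 : forall i x, 0 <= u i x.

Let sK : involutive s. Proof. by case: s_fold. Qed.

Let integrand (w : 'I_m -> 'rV[int]_d -> R) (x : {ffun 'I_m -> 'rV[int]_d}) : R :=
  G (\row_i w i (x i)) * riesz_kernel H x.

Let pu i := polarize psi s (u i).

Lemma riesz_kernel_ge0 (x : 'I_m -> 'rV[int]_d) : 0 <= riesz_kernel H x.
Proof. by apply: prodr_ge0 => i _; apply: prodr_ge0 => j ij; exact: H_ge0. Qed.

Lemma integrand_ge0 w x : (forall i y, 0 <= w i y) -> 0 <= integrand w x.
Proof.
move=> w0; apply: mulr_ge0; last exact: riesz_kernel_ge0.
by apply: G_ge0 => i; rewrite mxE.
Qed.

(** On the orbit of a tuple in the closed half-space of the centre, the kernel
    is a product of factors that see only whether [x i] and [x j] are both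
    reflected or both kept: these are ferromagnetic weights.  Polarization
    sorts the values, that is, undoes the flip by the set [D] of the indices
    at which the smaller value lies near the centre. *)
Lemma two_point_near (x : {ffun 'I_m -> 'rV[int]_d}) :
  (forall i, psi (x i) <= psi (s (x i)))%N ->
  \sum_(X : {set 'I_m}) integrand u (reflect_some s X x) <=
  \sum_(X : {set 'I_m}) integrand pu (reflect_some s X x).
Proof.
move=> xnear; have [_ s_fix s_isom s_near] := s_fold.
pose lo i := Num.min (u i (x i)) (u i (s (x i))).
pose hi i := Num.max (u i (x i)) (u i (s (x i))).
pose D := [set i | u i (x i) < u i (s (x i))]%SET.
pose g (X : {set 'I_m}) := G (\row_i if i \in X then lo i else hi i).
pose A (p : 'I_m * 'I_m) : R :=
  if (p.1 < p.2)%N then H p.1 p.2 (lattice_dist (x p.1) (x p.2))%:R else 1.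
pose B (p : 'I_m * 'I_m) : R :=
  if (p.1 < p.2)%N then H p.1 p.2 (lattice_dist (x p.1) (s (x p.2)))%:R else 1.
have gS : locally_supermodular g.
  apply: supermodular_box => // i; first by rewrite le_min !u_ge0.
  by rewrite /lo /hi ge_min !le_max lexx.
have B0 p : 0 <= B p by rewrite /B; case: ifP => // /H_ge0; exact.
have BA p : B p <= A p.
  rewrite /A /B; case: ifP => // lt12; apply: H_mono => //.
  by rewrite ler_nat; exact: s_near.
have kernelE X : riesz_kernel H (reflect_some s X x) =
    \prod_p (if (p.1 \in X) == (p.2 \in X) then A p else B p).
  rewrite /riesz_kernel pair_big_dep/= big_mkcond; apply: eq_bigr => -[i j] _ /=.
  rewrite /A /B /=; case: ifP => ij; last by case: ifP.
  rewrite !ffunE; case: (i \in X); case: (j \in X) => //=.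
    by rewrite s_isom.
  by rewrite -{1}(sK (x j)) s_isom.
have uE X : G (\row_i u i (reflect_some s X x i)) = g (flip D X).
  congr G; apply/rowP => i; rewrite !mxE ffunE in_flip finset.inE /lo /hi.
  by case: ltP => _; case: (i \in X).
have puE X : G (\row_i pu i (reflect_some s X x i)) = g X.
  congr G; apply/rowP => i; rewrite !mxE ffunE /pu /polarize /lo /hi.
  have := xnear i; rewrite leq_eqVlt => /orP[/eqP e|lt].
    have sx : s (x i) = x i by exact: s_fix.
    by case: (i \in X); rewrite !sx ltnn minxx ?maxxx.
  case: (i \in X); last by rewrite lt.
  by rewrite sK ltnNge (ltnW lt) /= minC.
rewrite /integrand; under eq_bigr do rewrite uE kernelE.
under [in leRHS]eq_bigr do rewrite puE kernelE.
exact: ferromagnetic_sum_le.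
Qed.

(** Every orbit contains a tuple near the centre: reflect the far coordinates. *)
Lemma two_point (x : {ffun 'I_m -> 'rV[int]_d}) :
  \sum_(X : {set 'I_m}) integrand u (reflect_some s X x) <=
  \sum_(X : {set 'I_m}) integrand pu (reflect_some s X x).
Proof.
pose far := [set i | psi (s (x i)) < psi (x i)]%N%SET.
have moveE w : \sum_(X : {set 'I_m}) integrand w (reflect_some s X x) =
    \sum_(X : {set 'I_m}) integrand w (reflect_some s X (reflect_some s far x)).
  rewrite (reindex_inj (inv_inj (flipK far))) /=; apply: eq_bigr => X _.
  congr (integrand w _); apply/ffunP => i; rewrite !ffunE in_flip.
  by case: (i \in X); case: (i \in far); rewrite /= ?sK.
rewrite !moveE; apply: two_point_near => i.
by rewrite ffunE finset.inE; case: ltnP => //; rewrite sK => /ltnW.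
Qed.

(** Summing the inequality over all tuples counts each of the two sides once for
    every set of reflected coordinates, since these reflections are bijections
    of the tuples.  All terms are nonnegative, so infinite sums are allowed. *)
Lemma riesz_sum_polarize : (riesz_sum G H u <= riesz_sum G H pu)%E.
Proof.
have twice w : (forall i y, 0 <= w i y) ->
    (#|{set 'I_m}|%:R%:E * riesz_sum G H w =
     \esum_(x in [set: {ffun 'I_m -> 'rV[int]_d}])
       (\sum_(X : {set 'I_m}) integrand w (reflect_some s X x))%:E)%E.
  move=> w0; rewrite -ge0_sume_const; last first.
    by apply: esum_ge0 => x _; rewrite lee_fin integrand_ge0.
  under eq_esum do rewrite -sumEFin.
  rewrite esum_sum; last by move=> *; rewrite lee_fin integrand_ge0.
  apply: eq_bigr => X _.
  rewrite -(@reindex_esum _ _ _ setT setT (reflect_some s X) (fun x => (integrand w x)%:E))//.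
  by rewrite setTT_bijective; apply: inv_bij; exact: reflect_someK.
have : (#|{set 'I_m}|%:R%:E * riesz_sum G H u <=
    #|{set 'I_m}|%:R%:E * riesz_sum G H pu)%E.
  rewrite (twice _ u_ge0) (twice pu); last by move=> i; exact: polarize_ge0.
  by apply: le_esum => x _; rewrite lee_fin; exact: two_point.
rewrite lee_pmul2l// lte_fin ltr0n.
by apply/card_gt0P; exists finset.set0.
Qed.
End two_point.

(** * Reflections of the lattice *)

Definition dotz (d : nat) (a b : 'rV[int]_d) : int := \sum_i a 0 i * b 0 i.

Lemma dotzDl (d : nat) (a b x : 'rV[int]_d) :
  dotz (a + b) x = dotz a x + dotz b x.
Proof. by rewrite -big_split; apply: eq_bigr => i _; rewrite mxE mulrDl. Qed.

Lemma dotzZl (d : nat) (k : int) (a x : 'rV[int]_d) :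
  dotz (k *: a) x = k * dotz a x.
Proof. by rewrite [RHS]mulr_sumr; apply: eq_bigr => i _; rewrite mxE mulrA. Qed.

Lemma dotzC (d : nat) (a b : 'rV[int]_d) : dotz a b = dotz b a.
Proof. by apply: eq_bigr => i _; rewrite mulrC. Qed.

Lemma dotz_delta (d : nat) (i : 'I_d) (x : 'rV[int]_d) :
  dotz (delta_mx 0 i) x = x 0 i.
Proof.
rewrite /dotz (bigD1 i)//= mxE !eqxx mul1r big1 ?addr0// => k ki.
by rewrite mxE (negbTE ki) andbF mul0r.
Qed.

(** The centre is the point [pole / (2 * d + 2)].  Its coordinates are
    decreasing and lie strictly between 0 and 1/2, hence its inner product with
    every direction lies strictly between 0 and 1/2 as well.  So it is on no
    reflection wall, and on each line parallel to [e] the order by distance to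
    the level 1/4, which the one-dimensional rearrangement uses, is compatible
    with all reflections that move points towards the centre. *)
Definition pole (d : nat) : 'rV[int]_d := \row_i (d - i)%:Z.

(** The squared Euclidean distance to the centre, scaled to be an integer. *)
Definition moment (d : nat) (x : 'rV[int]_d) : nat :=
  (\sum_i `|((2 * d + 2)%:Z * x 0 i - pole d 0 i)%R| ^ 2)%N.

Definition reflection (d : nat) (v w : 'rV[int]_d) (c : int) (x : 'rV[int]_d) :
    'rV[int]_d := x + (c - dotz w x) *: v.

(** For a direction [e], [v] is the primitive lattice vector parallel to [e] and
    [w] is [2 * e], the functional whose level sets are the reflection walls.
    The last two fields say that the graph distance respects the reflections. *)
Record is_root (d : nat) (e : 'rV[rat]_d) (v w : 'rV[int]_d) (l : int) : Prop := {
  root_gt0 : 0 < l;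
  root_dir : forall i, (w 0 i)%:~R = 2 * e 0 i :> rat;
  root_scale : l *: w = 2 *: v;
  root_dot : dotz w v = 2;
  root_pivot : exists i, v 0 i = 1;
  root_pole : 0 < dotz w (pole d) < (2 * d + 2)%:Z;
  root_isom : forall c x y,
    lattice_dist (reflection v w c x) (reflection v w c y) = lattice_dist x y;
  root_near : forall c x y, 0 <= (c - dotz w x) * (c - dotz w y) ->
    (lattice_dist x y <= lattice_dist x (reflection v w c y))%N }.

Lemma is_root_unit (d : nat) (i : 'I_d) :
  is_root (unit_vec i) (delta_mx 0 i) (2 *: delta_mx 0 i) 1.
Proof.
have dotE x : dotz (2 *: delta_mx 0 i) x = 2 * x 0 i.
  by rewrite dotzZl dotz_delta.
have distE (x y : 'rV[int]_d) : lattice_dist x y =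
    (`|(x 0 i - y 0 i)%R| + \sum_(k < d | k != i) `|(x 0 k - y 0 k)%R|)%N.
  by rewrite /lattice_dist (bigD1 i).
pose r c x := reflection (delta_mx 0 i) (2 *: delta_mx 0 i : 'rV[int]_d) c x.
have ri c x : r c x 0 i = c - x 0 i.
  by rewrite /r /reflection dotE !mxE !eqxx /= mulr1; lia.
have rk c x k : k != i -> r c x 0 k = x 0 k.
  by move=> ki; rewrite /r /reflection !mxE (negbTE ki) andbF mulr0 addr0.
split => //.
- by move=> k; rewrite !mxE rmorphM /=; case: (k == i).
- by rewrite scale1r.
- by rewrite dotE mxE !eqxx.
- by exists i; rewrite mxE !eqxx.
- by rewrite dotE mxE; have := ltn_ord i; lia.
- move=> c x y; rewrite -/(r c x) -/(r c y) !distE !ri; congr addn; first lia.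
  by apply: eq_bigr => k ki; rewrite !rk.
- move=> c x y; rewrite -/(r c y) !dotE !distE ri => h.
  rewrite leq_add//; last by apply: leq_sum => k ki; rewrite rk.
  have [?|?] : (0 <= c - 2 * x 0 i /\ 0 <= c - 2 * y 0 i) \/
               (c - 2 * x 0 i <= 0 /\ c - 2 * y 0 i <= 0) by nia.
    lia.
  lia.
Qed.

Lemma is_root_pair (d : nat) (i j : 'I_d) (t : int) :
  (i < j)%N -> t = 1 \/ t = -1 ->
  is_root (2^-1 *: (unit_vec i + t%:~R *: unit_vec j))
    (delta_mx 0 i + t *: delta_mx 0 j) (delta_mx 0 i + t *: delta_mx 0 j) 2.
Proof.
move=> ij ht; have nij : j != i by rewrite neq_ltn ij orbT.
set v : 'rV[int]_d := _ + _.
have dotE x : dotz v x = x 0 i + t * x 0 j by rewrite dotzDl dotzZl !dotz_delta.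
have vi : v 0 i = 1 by rewrite !mxE !eqxx eq_sym (negbTE nij) /= mulr0.
have vj : v 0 j = t by rewrite !mxE !eqxx (negbTE nij) /= mulr1 add0r.
have vk k : k != i -> k != j -> v 0 k = 0.
  by move=> /negbTE ki /negbTE kj; rewrite !mxE ki kj /= mulr0.
have distE (x y : 'rV[int]_d) : lattice_dist x y =
    (`|(x 0 i - y 0 i)%R| + (`|(x 0 j - y 0 j)%R| +
     \sum_(k < d | (k != i) && (k != j)) `|(x 0 k - y 0 k)%R|))%N.
  by rewrite /lattice_dist (bigD1 i)//= (bigD1 j).
pose r c x := reflection v v c x.
have ri c x : r c x 0 i = c - t * x 0 j.
  by rewrite /r /reflection dotE mxE [X in _ + X]mxE vi; ring.
have rj c x : r c x 0 j = t * c - t * x 0 i.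
  rewrite /r /reflection dotE mxE [X in _ + X]mxE vj; case: ht => ->; ring.
have rk c x k : (k != i) && (k != j) -> r c x 0 k = x 0 k.
  by move=> /andP[ki kj]; rewrite /r /reflection mxE [X in _ + X]mxE vk// mulr0 addr0.
split => //.
- move=> k; rewrite !mxE rmorphD rmorphM /= mulrA divff// mul1r.
  by congr (_ + _ * _); case: (k == _).
- by rewrite dotE vi vj; case: ht => ->.
- by exists i.
- by rewrite dotE !mxE; have := ltn_ord j; case: ht => ->; lia.
- move=> c x y; rewrite -/(r c x) -/(r c y) !distE !ri !rj !addnA; congr addn.
    by case: ht => ->; lia.
  by apply: eq_bigr => k ki; rewrite !rk.
- move=> c x y; rewrite -/(r c y) !dotE !distE ri rj !addnA => h.
  rewrite leq_add//; last by apply: leq_sum => k ki; rewrite rk.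
  move: h; set a := c - _; set b := c - _ => h.
  have : (0 <= a /\ 0 <= b) \/ (a <= 0 /\ b <= 0) by nia.
  by rewrite {h}/a {}/b; case: ht => ->; lia.
Qed.

Lemma directions_root (d : nat) (e : 'rV[rat]_d) :
  directions e -> exists v w l, is_root e v w l.
Proof.
case=> [[i ->]|[i [j [ij [->|->]]]]].
- by do 3!eexists; exact: is_root_unit.
- do 3!eexists; have := is_root_pair ij (or_introl erefl).
  by rewrite [_ *: unit_vec j]scale1r; apply.
- do 3!eexists; have := is_root_pair ij (or_intror erefl).
  by rewrite [_ *: unit_vec j]scaleN1r; apply.
Qed.

Lemma momentE (d : nat) (x : 'rV[int]_d) :
  (moment x)%:Z = \sum_i ((2 * d + 2)%:Z * x 0 i - pole d 0 i) ^+ 2.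
Proof.
rewrite /moment (big_morph Posz PoszD erefl); apply: eq_bigr => i _.
by rewrite -abszX gez0_abs ?sqr_ge0.
Qed.

Section root.
Variables (d : nat) (e : 'rV[rat]_d) (v w : 'rV[int]_d) (l : int).
Hypothesis root : is_root e v w l.

Let N : int := (2 * d + 2)%:Z.

Lemma dotz_reflection c x : dotz w (reflection v w c x) = 2 * c - dotz w x.
Proof.
by rewrite dotzC dotzDl dotzZl dotzC [dotz v w]dotzC (root_dot root); ring.
Qed.

Lemma reflectionK c : involutive (reflection v w c).
Proof.
move=> x; rewrite {1}/reflection dotz_reflection /reflection -addrA -scalerDl.
have -> : c - dotz w x + (c - (2 * c - dotz w x)) = 0 by ring.
by rewrite scale0r addr0.
Qed.

(** Expanding the square, the quadratic term and the linear one combine because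
    [v] and [w] are parallel and [dotz w v = 2]. *)
Lemma moment_reflection c x :
  (moment (reflection v w c x))%:Z - (moment x)%:Z =
  N * l * (c - dotz w x) * (N * c - dotz w (pole d)).
Proof.
have lw i : l * w 0 i = 2 * v 0 i.
  by have /rowP/(_ i) := root_scale root; rewrite !mxE.
have vv : \sum_i v 0 i * v 0 i = l.
  have : l * dotz w v = 2 * \sum_i v 0 i * v 0 i.
    by rewrite !mulr_sumr; apply: eq_bigr => i _; rewrite mulrA lw mulrA.
  by rewrite (root_dot root); lia.
set t := c - dotz w x; rewrite !momentE -sumrB -/N.
transitivity (\sum_i N * t * (l * (N * (w 0 i * x 0 i) - w 0 i * pole d 0 i) +
    N * t * (v 0 i * v 0 i))).
  apply: eq_bigr => i _; have -> : reflection v w c x 0 i = x 0 i + t * v 0 i by rewrite !mxE.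
  have -> : l * (N * (w 0 i * x 0 i) - w 0 i * pole d 0 i) =
      (l * w 0 i) * (N * x 0 i - pole d 0 i) by ring.
  by rewrite lw; ring.
rewrite -mulr_sumr big_split /= -!mulr_sumr sumrB -mulr_sumr vv -/(dotz w x).
by rewrite -/(dotz w _) /t; ring.
Qed.

Lemma pole_off_wall c : N * c - dotz w (pole d) != 0.
Proof.
have /andP[] := root_pole root; rewrite -/N; move: (dotz _ _) (N) => p n p0 pn.
apply/eqP => h; have [c0|c0] : c <= 0 \/ 1 <= c by lia.
  by nia.
by nia.
Qed.

(** So a point is nearer to the centre than its mirror image exactly when it is on
    the same side of the wall as the centre. *)
Lemma moment_reflection_le c x :
  (moment x <= moment (reflection v w c x))%N =
  (0 <= (c - dotz w x) * (N * c - dotz w (pole d))).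
Proof.
have := moment_reflection c x; have := root_gt0 root.
have N0 : 0 < N by rewrite /N; lia.
move: (moment _) (moment x) => a b l0 ab.
have {}ab : a%:Z - b%:Z = N * l * ((c - dotz w x) * (N * c - dotz w (pole d))).
  by rewrite ab !mulrA.
rewrite -(@pmulr_rge0 _ (N * l)) ?mulr_gt0// -ab.
by lia.
Qed.

Lemma reflection_folding c : folding (@moment d) (reflection v w c).
Proof.
split.
- exact: reflectionK.
- move=> x xE; have := moment_reflection c x; rewrite xE subrr => /esym/eqP.
  rewrite !mulf_eq0 (negbTE (pole_off_wall c)) orbF.
  have /gt_eqF-> := root_gt0 root; have -> : (N == 0) = false by rewrite /N; lia.
  by rewrite /= => /eqP h; rewrite /reflection h scale0r addr0.
- exact: root_isom root c.
- move=> x y; rewrite !moment_reflection_le => hx hy; apply: (root_near root).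
  have := pole_off_wall c; set k := N * c - _ in hx hy * => k0.
  by case: (ltgtP k 0) k0 => // k0 _; nia.
Qed.

Lemma inner_root x : 2 * inner e x = (dotz w x)%:~R.
Proof.
rewrite /inner /dotz rmorph_sum mulr_sumr; apply: eq_bigr => i _ /=.
by rewrite rmorphM /= (root_dir root) mulrA.
Qed.

Lemma parallel_classP x y :
  parallel_class e x y <-> exists k : int, y = x + k *: v.
Proof.
have lw i : l%:~R * (2 * e 0 i) = 2 * (v 0 i)%:~R :> rat.
  rewrite -(root_dir root) -intrM.
  have /rowP/(_ i) := root_scale root; rewrite !mxE => ->.
  by rewrite intrM.
have l0 : l%:~R != 0 :> rat by rewrite intr_eq0 gt_eqF ?(root_gt0 root).
have ev i : e 0 i = l%:~R^-1 * (v 0 i)%:~R.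
  have := lw i; rewrite mulrCA => /(mulfI (_ : 2 != 0 :> rat)) => h.
  by rewrite -h// mulKf.
split=> [[c h]|[k ->]].
  have [i vi] := root_pivot root.
  have cE : c / l%:~R = (y 0 i - x 0 i)%:~R.
    by have /rowP/(_ i) := h; rewrite !mxE ev vi mulr1 => <-.
  exists (y 0 i - x 0 i); apply/rowP => j; rewrite mxE [X in _ + X]mxE.
  have /rowP/(_ j) := h; rewrite !mxE ev mulrA cE -intrM => /intr_inj <-.
  by rewrite addrC subrK.
exists (k%:~R * l%:~R); apply/rowP => i; rewrite !mxE ev addrC addKr.
by rewrite intrM mulrA mulfK.
Qed.

Lemma parallel_class_reflection c x : parallel_class e x (reflection v w c x).
Proof. by apply/parallel_classP; eexists. Qed.

Lemma parallel_class_refl x : parallel_class e x x.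
Proof. by apply/parallel_classP; exists 0; rewrite scale0r addr0. Qed.

Lemma parallel_class_trans x y z :
  parallel_class e x y -> parallel_class e y z -> parallel_class e x z.
Proof.
move=> /parallel_classP[k ->] /parallel_classP[k' ->]; apply/parallel_classP.
by exists (k + k'); rewrite scalerDl addrA.
Qed.

Lemma parallel_class_sym x y : parallel_class e x y -> parallel_class e y x.
Proof.
move=> /parallel_classP[k ->]; apply/parallel_classP.
by exists (- k); rewrite scaleNr addrK.
Qed.

End root.

(** * The potential *)

Section ball.
Variable d : nat.

Definition ball_seq (r : nat) : seq 'rV[int]_d :=
  undup [seq x <- [seq \row_i ((f i : nat)%:Z - (r + d)%:Z)
                   | f : {ffun 'I_d -> 'I_(2 * (r + d)).+1}] | (moment x <= r)%N].

Lemma mem_ball_seq r x : (x \in ball_seq r) = (moment x <= r)%N.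
Proof.
rewrite mem_undup mem_filter; case: leqP => //= xr.
have xi i : (`|(x 0 i)%R| <= r + d)%N.
  have h : (`|((2 * d + 2)%:Z * x 0 i - pole d 0 i)%R| ^ 2 <= r)%N.
    by apply: leq_trans xr; rewrite /moment (bigD1 i)//= leq_addr.
  rewrite mxE in h; have := ltn_ord i; set a := `|_|%N in h.
  have {}h : (a <= r)%N by nia.
  by rewrite /a in h; nia.
apply/mapP; exists [ffun i => inord `|(x 0 i + (r + d)%:Z)%R|%N].
  by rewrite mem_enum.
apply/rowP => i; rewrite !mxE ffunE inordK; have := xi i; lia.
Qed.

End ball.

(** Replacing values by their ranks among finitely many makes the potential below
    integer-valued, so that its decrease is well founded. *)
Definition rank_in (R : realType) (V : seq R) (a : R) : nat :=
  count (fun b => b < a) V.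

Lemma rank_in_le (R : realType) (V : seq R) : {homo rank_in V : a b / a <= b >-> (a <= b)%N}.
Proof. by move=> a b ab; apply: sub_count => c /lt_le_trans; exact. Qed.

Lemma rank_in_lt (R : realType) (V : seq R) (a b : R) :
  a \in V -> a < b -> (rank_in V a < rank_in V b)%N.
Proof.
move=> aV ab; elim: V aV => //= c V IH; rewrite inE => /predU1P[<-|aV].
  by rewrite ltxx ab add0n add1n ltnS rank_in_le// ltW.
rewrite -addnS leq_add ?IH//; case: (ltP c a) => // ca.
by rewrite (lt_trans ca ab).
Qed.

Definition bounded_in (R : realType) (d : nat) (V : seq R) (r : nat)
    (u : 'rV[int]_d -> R) : Prop :=
  [/\ (forall a, a \in V -> 0 <= a), (forall x, u x \in V) &
      (forall x, (r < moment x)%N -> u x = 0)].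

Definition potential (R : realType) (d : nat) (V : seq R) (r : nat)
    (u : 'rV[int]_d -> R) : nat :=
  (\sum_(x <- ball_seq d r) rank_in V (u x) * moment x)%N.

Section potential.
Variables (R : realType) (d : nat) (V : seq R) (r : nat).
Variables (s : 'rV[int]_d -> 'rV[int]_d) (u : 'rV[int]_d -> R).
Hypothesis s_fold : folding (@moment d) s.
Hypothesis u_bounded : bounded_in V r u.

Let u_ge0 x : 0 <= u x. Proof. by case: u_bounded => V0 uV _; exact: V0. Qed.

Let pu := polarize (@moment d) s u.

Lemma polarize_bounded : bounded_in V r pu.
Proof.
have [V0 uV ur] := u_bounded.
split=> // x; rewrite /pu /polarize.
  case: ifP => _; first by case: (leP (u x) (u (s x))).
  by case: (leP (u x) (u (s x))).
move=> rx; rewrite (ur x rx); case: ifP => lt.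
  by rewrite ur ?maxxx// (ltn_trans rx).
by rewrite min_l.
Qed.

Lemma rank_in0 : rank_in V 0 = 0%N.
Proof.
have [V0 _ _] := u_bounded; apply/eqP; rewrite -leqn0 leqNgt -has_count.
by apply/hasPn => a aV; rewrite -leNgt V0.
Qed.

Let weight (f : 'rV[int]_d -> R) x := (rank_in V (f x) * moment x)%N.

(** The rearrangement inequality for two points: exchanging the values at [x] and
    [s x] so that the larger value gets the smaller moment decreases the sum. *)
Lemma weight_pair x :
  (weight pu x + weight pu (s x) <= weight u x + weight u (s x))%N /\
  (pu x <> u x ->
   weight pu x + weight pu (s x) < weight u x + weight u (s x))%N.
Proof.
have [sK s_fix _ _] := s_fold; have [_ uV _] := u_bounded.
rewrite /weight /pu /polarize sK.
have [lt|lt|e] := ltngtP (moment x) (moment (s x)).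
- case: (leP (u x) (u (s x))) => [le|//].
  have := rank_in_le V le; rewrite le_eqVlt in le.
  case/orP: le => [/eqP->//|/(rank_in_lt (uV x))].
  by split; nia.
- case: (leP (u x) (u (s x))) => [//|le].
  have := rank_in_lt (uV (s x)) le.
  by split; nia.
- by rewrite s_fix// !minxx.
Qed.

(** A ball around the centre is not stable under [s], so the sum is first extended
    to the union [B] of the ball and its mirror image, where all added terms are
    0; then the terms at [x] and [s x] are compared in pairs. *)
Lemma potential_polarize : pu <> u -> (potential V r pu < potential V r u)%N.
Proof.
move=> pu_neq.
have [sK s_fix _ _] := s_fold; have [_ _ ur] := u_bounded.
pose B := undup (ball_seq d r ++ map s (ball_seq d r)).
have memB x : (x \in B) = (moment x <= r)%N || (moment (s x) <= r)%N.
  by rewrite mem_undup mem_cat mem_ball_seq -{2}(sK x) (mem_map (inv_inj sK))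
    mem_ball_seq.
have sB (f : 'rV[int]_d -> nat) : (\sum_(x <- B) f (s x) = \sum_(x <- B) f x)%N.
  rewrite -(big_map s xpredT f); apply: perm_big; apply: uniq_perm.
  - by rewrite (map_inj_uniq (inv_inj sK)) undup_uniq.
  - exact: undup_uniq.
  - by move=> x; rewrite -{1}(sK x) (mem_map (inv_inj sK)) !memB sK orbC.
have potB f : bounded_in V r f -> potential V r f = (\sum_(x <- B) weight f x)%N.
  move=> [_ _ fr]; rewrite /potential [RHS](bigID [pred x | moment x <= r]%N)/=.
  rewrite [X in (_ + X)%N]big1 ?addn0 => [|x]; last first.
    by rewrite -ltnNge => /fr; rewrite /weight => ->; rewrite rank_in0.
  rewrite -[RHS]big_filter; apply: perm_big; apply: uniq_perm.
  - exact: undup_uniq.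
  - by rewrite filter_uniq// undup_uniq.
  - by move=> x; rewrite mem_filter mem_ball_seq memB /=; case: leqP.
rewrite (potB _ polarize_bounded) (potB _ u_bounded).
have twice f : (2 * \sum_(x <- B) weight f x =
    \sum_(x <- B) (weight f x + weight f (s x)))%N.
  by rewrite big_split /= (sB (weight f)) mul2n addnn.
rewrite -(@ltn_pmul2l 2)// !twice.
have [x0 px0] : exists x, pu x <> u x.
  by apply: contrapT => /forallNP h; apply: pu_neq; apply/funext => x; exact: contrapT.
have x0B : x0 \in B.
  rewrite memB; apply: contrapT => /negP; rewrite negb_or -!ltnNge => /andP[h1 h2].
  by apply: px0; rewrite /pu /polarize !ur// minxx maxxx if_same.
rewrite (bigD1_seq x0)//= ?undup_uniq// [ltnRHS](bigD1_seq x0)//= ?undup_uniq//.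
rewrite -addSn leq_add//; first exact: (weight_pair x0).2.
by apply: leq_sum => x _; exact: (weight_pair x).1.
Qed.

End potential.

Local Open Scope classical_set_scope.

(** * The one-step rearrangement as a polarized function *)

(** Superlevel sets shrink as the level grows, so two distinct levels would
    contradict each other. *)
Lemma is_nth_largest_uniq (R : realType) (T : Type) (D : set T) (w : T -> R)
    (n : nat) (a b : R) :
  is_nth_largest D w n a -> is_nth_largest D w n b -> a = b.
Proof.
have half c c' : is_nth_largest D w n c -> is_nth_largest D w n c' -> c' <= c.
  move=> [nc _] [_ c'n]; rewrite leNgt; apply/negP => cc'; apply: nc.
  apply: card_le_trans c'n _; apply: subset_card_le => x [Dx c'x]; split=> //.
  exact: lt_le_trans c'x.
by move=> ha hb; apply/eqP; rewrite eq_le !half.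
Qed.

Lemma nth_largestE (R : realType) (T : Type) (D : set T) (w : T -> R)
    (n : nat) (a : R) : is_nth_largest D w n a -> nth_largest D w n = a.
Proof. by move=> ha; apply: xget_unique => // b /is_nth_largest_uniq; exact. Qed.

(** The n-th largest value depends only on the cardinals of superlevel sets, which
    an injection preserves. *)
Lemma is_nth_largest_image (R : realType) (T U : Type) (f : U -> T) (A : set U)
    (w : T -> R) (w' : U -> R) (n : nat) (a : R) :
  {in A &, injective f} -> (forall y, A y -> w (f y) = w' y) ->
  is_nth_largest A w' n a -> is_nth_largest (f @` A) w n a.
Proof.
move=> finj wf [an na].
have card (P : R -> bool) :
    ([set x | (f @` A) x /\ P (w x)] #= [set y | A y /\ P (w' y)])%card.
  have -> : [set x | (f @` A) x /\ P (w x)] = f @` [set y | A y /\ P (w' y)].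
    apply/seteqP; split=> [x [[y Ay <-]] Py|_ [y [Ay Py] <-]].
      by exists y => //; split=> //; rewrite -wf.
    by split; [exists y|rewrite wf].
  apply: inj_card_eq => y z /set_mem[Ay _] /set_mem[Az _].
  by apply: finj; exact: mem_set.
split; first by rewrite (card_le_eqr (card (fun b => a < b))).
by rewrite (card_le_eqr (card (fun b => a <= b))).
Qed.

Lemma nth_largest_ge0 (R : realType) (T : Type) (D : set T) (w : T -> R)
    (n : nat) : (forall x, 0 <= w x) -> 0 <= nth_largest D w n.
Proof.
move=> w0; rewrite /nth_largest; case: xgetP => // a -> [na an].
rewrite leNgt; apply/negP => a0; apply: na; apply: card_le_trans an _.
by apply: subset_card_le => x [Dx _]; split=> //; exact: lt_le_trans (w0 x).
Qed.

(** Each polarization, hence each composite of them, is a permutation of the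
    values within the lines parallel to [e]. *)
Definition rearranged_along (R : realType) (d : nat) (e : 'rV[rat]_d)
    (u u' : 'rV[int]_d -> R) : Prop :=
  exists t : 'rV[int]_d -> 'rV[int]_d,
    [/\ bijective t, (forall x, parallel_class e x (t x)) & u' = u \o t].

Section line.
Variables (R : realType) (d : nat) (e : 'rV[rat]_d) (v w : 'rV[int]_d) (l : int).
Hypothesis root : is_root e v w l.

Lemma rearranged_along_refl (u : 'rV[int]_d -> R) : rearranged_along e u u.
Proof.
exists id; split=> //; first by exists id.
by move=> x; exact: (parallel_class_refl root).
Qed.

Lemma rearranged_along_trans (u1 u2 u3 : 'rV[int]_d -> R) :
  rearranged_along e u1 u2 -> rearranged_along e u2 u3 -> rearranged_along e u1 u3.
Proof.
move=> [t [tb te ->]] [t' [tb' te' ->]]; exists (t \o t'); split=> //.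
  exact: bij_comp.
by move=> x; exact: (parallel_class_trans root (te' x)).
Qed.

(** The permutation exchanges [x] with its mirror image exactly when the two values
    are in the wrong order; this condition is symmetric. *)
Lemma rearranged_along_polarize (c : int) (u : 'rV[int]_d -> R) :
  rearranged_along e u (polarize (@moment d) (reflection v w c) u).
Proof.
set s := reflection v w c.
have [sK s_fix _ _] : folding (@moment d) s := reflection_folding root c.
pose swap x := (moment x < moment (s x))%N && (u x < u (s x)) ||
               (moment (s x) < moment x)%N && (u (s x) < u x).
pose t x := if swap x then s x else x.
exists t; split.
- apply: inv_bij => x; rewrite /t.
  have swapE : swap (s x) = swap x by rewrite /swap sK orbC.
  by case sx: (swap x); rewrite ?swapE sx ?sK.
- move=> x; rewrite /t; case: ifP => _.
    exact: (parallel_class_reflection root).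
  exact: (parallel_class_refl root).
apply/funext => x; rewrite /polarize /= /t /swap.
have [lt|lt|eq] := ltngtP (moment x) (moment (s x)).
- by rewrite orbF /=; case: ltP.
- by rewrite /=; case: (ltP (u (s x)) (u x)).
- by rewrite s_fix// minxx ?if_same.
Qed.

Definition line_rank (x : 'rV[int]_d) : nat := rank_index (inner e x).

(** On a line the integer [dotz w x] runs through a residue class mod 2, and the
    rank enumerates that class as 0, 2, -2, 4, ... or as 1, -1, 3, -3, ... *)
Lemma line_rankE x : line_rank x =
  `|(if dotz w x <= 0 then 1 - dotz w x else dotz w x)%R|%N.
Proof.
rewrite /line_rank /rank_index; have := inner_root root x.
move: (inner e x) (dotz w x) => s a sa.
have -> : (s <= 0) = (a <= 0).
  by rewrite -(@ler_int rat) -sa pmulr_rle0.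
have trunc (b : int) : 0 <= b -> Num.truncn (b%:~R : rat) = `|b|%N.
  by case: b => // n _; rewrite -pmulrn natrK.
rewrite sa; case: ifP => a0; last by rewrite trunc//; lia.
have -> : 1 - a%:~R = (1 - a)%:~R :> rat by rewrite rmorphB.
by rewrite trunc//; lia.
Qed.

Lemma line_rank_gt0 x : (0 < line_rank x)%N.
Proof. by rewrite line_rankE; case: ifP; lia. Qed.

Lemma dotz_shift x k : dotz w (x + k *: v) = dotz w x + 2 * k.
Proof.
by rewrite dotzC dotzDl dotzZl dotzC [dotz v w]dotzC (root_dot root) mulrC.
Qed.

Lemma line_rank_inj x : {in parallel_class e x &, injective line_rank}.
Proof.
move=> y z /set_mem/(parallel_classP root)[k ->].
move=> /set_mem/(parallel_classP root)[k' ->].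
rewrite !line_rankE !dotz_shift => h; congr (_ + _ *: _).
by move: h; case: ifP; case: ifP; lia.
Qed.

Lemma line_rank_surj x n : (0 < n)%N ->
  exists2 y, parallel_class e x y & line_rank y = n.
Proof.
move=> n0.
have [[k hk]|[k hk]] : (exists k, n%:Z = dotz w x + 2 * k) \/
                   (exists k, 1 - n%:Z = dotz w x + 2 * k).
  have [b [h hb]] : exists b : int, (b = 0 \/ b = 1) /\ exists k, n%:Z = dotz w x + 2 * k + b.
    exists ((n%:Z - dotz w x) %% 2)%Z; split.
      by have := modz_ge0 (n%:Z - dotz w x) (isT : 2%:Z != 0);
         have := ltz_pmod (n%:Z - dotz w x) (isT : 0 < 2%:Z); lia.
    exists ((n%:Z - dotz w x) %/ 2)%Z.
    by have := divz_eq (n%:Z - dotz w x) 2; lia.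
  case: hb => k hb; case: h => h; first by left; exists k; lia.
  by right; exists (- k - dotz w x); lia.
- exists (x + k *: v); first by apply/(parallel_classP root); exists k.
  by rewrite line_rankE dotz_shift -hk; case: ifP; lia.
- exists (x + k *: v); first by apply/(parallel_classP root); exists k.
  by rewrite line_rankE dotz_shift -hk; case: ifP; lia.
Qed.

(** Two points of a line are exchanged by the reflection in their midpoint, and the
    one of smaller rank is the nearer to the centre. *)
Lemma polarized_le (u : 'rV[int]_d -> R) x y :
  (forall c, polarize (@moment d) (reflection v w c) u = u) ->
  parallel_class e x y -> (line_rank y <= line_rank x)%N -> u x <= u y.
Proof.
move=> ufix /[dup] xy /(parallel_classP root)[k yE].
rewrite leq_eqVlt => /orP[/eqP h|lt].
  suff -> : x = y by [].
  apply/esym/(line_rank_inj (x := x)) => //; apply/mem_set => //.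
  exact: (parallel_class_refl root).
pose c := dotz w x + k.
have syx : reflection v w c y = x.
  rewrite /reflection yE dotz_shift -addrA -scalerDl.
  have -> : k + (c - (dotz w x + 2 * k)) = 0 by rewrite /c; ring.
  by rewrite scale0r addr0.
have near : (moment y < moment (reflection v w c y))%N.
  have [_ s_fix _ _] := reflection_folding root c.
  rewrite ltn_neqAle; apply/andP; split.
    by apply/eqP => /esym/s_fix; rewrite syx => xy0; rewrite xy0 ltnn in lt.
  rewrite (moment_reflection_le root) yE dotz_shift.
  have -> : c - (dotz w x + 2 * k) = - k by rewrite /c; ring.
  move: lt; rewrite !line_rankE yE dotz_shift /c => lt.
  have /andP[] := root_pole root.
  move: (dotz w (pole d)) (2 * d + 2)%N lt => p N; move: (dotz w x) => a lt p0 pN.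
  have [c1|c0] : 1 <= a + k \/ a + k <= 0 by lia.
    have : k <= 0 by move: lt; case: ifP; case: ifP; lia.
    by move=> k0; apply: mulr_ge0; nia.
  have : 0 <= k by move: lt; case: ifP; case: ifP; lia.
  by move=> k0; apply: mulr_le0; nia.
by rewrite -[in leRHS](ufix c) /polarize near syx le_max lexx orbT.
Qed.

End line.

Section sorted_line.
Variables (R : realType) (d : nat) (e : 'rV[rat]_d) (v w : 'rV[int]_d) (l : int).
Hypothesis root : is_root e v w l.

(** A function fixed by all polarizations is nonincreasing in the rank, and exactly
    one point of the line has each positive rank. *)
Lemma polarized_nth_largest (u : 'rV[int]_d -> R) x :
  (forall c, polarize (@moment d) (reflection v w c) u = u) ->
  is_nth_largest (parallel_class e x) u (line_rank e x) (u x).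
Proof.
move=> ufix; have n0 := line_rank_gt0 root x; split.
  pose A := [set y | parallel_class e x y /\ (line_rank e y < line_rank e x)%N].
  have injA : {in A &, injective (fun y => (line_rank e y).-1)}.
    move=> y z /set_mem[xy _] /set_mem[xz _] yz.
    apply: (line_rank_inj root (x := x)); [exact: mem_set|exact: mem_set|].
    by rewrite -(prednK (line_rank_gt0 root y)) yz prednK// (line_rank_gt0 root).
  move=> h; have {h} : (`I_(line_rank e x) #<= A)%card.
    apply: card_le_trans h _; apply: subset_card_le => y [xy uxy]; split=> //.
    rewrite ltnNge; apply/negP => yx; move: uxy; rewrite ltNge => /negP; apply.
    apply: (polarized_le root ufix) yx.
    exact: (parallel_class_sym root).
  rewrite -(card_le_eqr (inj_card_eq injA)) => h.
  have : (`I_(line_rank e x) #<= `I_(line_rank e x).-1)%card.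
    apply: card_le_trans h _; apply: subset_card_le => _ [y [_ yx] <-] /=.
    by rewrite -ltnS !prednK// (line_rank_gt0 root).
  by rewrite card_le_II; case: (line_rank e x) n0 => // n _; rewrite ltnn.
pose A := [set y | parallel_class e x y /\ (line_rank e y <= line_rank e x)%N].
apply: (@card_le_trans _ _ _ A); last first.
  apply: subset_card_le => y [xy yx]; split=> //.
  exact: (polarized_le root ufix xy yx).
apply: card_le_trans (card_image_le (fun y => (line_rank e y).-1) A).
apply: subset_card_le => k /= kn.
have [y xy yk] := line_rank_surj root x (ltn0Sn k).
by exists y; [split=> //; rewrite yk|rewrite yk].
Qed.

Lemma polarized_rearr_line (u u' : 'rV[int]_d -> R) x :
  (forall c, polarize (@moment d) (reflection v w c) u' = u') ->
  rearranged_along e u u' ->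
  let V := parallel_class e x in
  is_nth_largest (inner e @` V) (u \o 'pinv_(fun=> x) V (inner e))
    (line_rank e x) (u' x).
Proof.
move=> ufix [t [tb te u'E]] V.
have tV y : V y -> V (t y).
  by move=> xy; exact: (parallel_class_trans root xy).
have injV : {in V &, injective (inner e)}.
  move=> y z yV zV yz; apply: (line_rank_inj root yV zV).
  by rewrite /line_rank yz.
have -> : inner e @` V = (inner e \o t) @` V.
  apply/seteqP; split=> [_ [y xy <-]|_ [y xy <-]]; last by exists (t y) => //; exact: tV.
  have [t' tK t'K] := tb; exists (t' y); rewrite /= ?t'K//.
  apply: (parallel_class_trans root xy); apply: (parallel_class_sym root).
  by rewrite -{2}(t'K y).
apply: (is_nth_largest_image (w' := u')).
- move=> y z /set_mem yV /set_mem zV /= h; apply: (bij_inj tb).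
  by apply: injV h; apply/mem_set/tV.
- by move=> y Vy; rewrite /= pinvKV ?u'E//; apply/mem_set/tV.
- exact: polarized_nth_largest.
Qed.

(** The one-step rearrangement is the only permutation of the values within the
    lines that is fixed by all polarizations. *)
Lemma rearr_step_polarized (u u' : 'rV[int]_d -> R) :
  (forall c, polarize (@moment d) (reflection v w c) u' = u') ->
  rearranged_along e u u' -> rearr_step e u = u'.
Proof.
move=> ufix ual; apply/funext => x; apply: nth_largestE.
exact: polarized_rearr_line.
Qed.

End sorted_line.

(** * Iterated rearrangements of functions with finite support *)

Definition tuple_bounded (R : realType) (d m : nat) (V : 'I_m -> seq R)
    (r : 'I_m -> nat) (u : 'I_m -> 'rV[int]_d -> R) : Prop :=
  forall i, bounded_in (V i) (r i) (u i).

Definition tuple_potential (R : realType) (d m : nat) (V : 'I_m -> seq R)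
    (r : 'I_m -> nat) (u : 'I_m -> 'rV[int]_d -> R) : nat :=
  (\sum_i potential (V i) (r i) (u i))%N.

Lemma tuple_potential_polarize (R : realType) (d m : nat) (V : 'I_m -> seq R)
    (r : 'I_m -> nat) (s : 'rV[int]_d -> 'rV[int]_d)
    (u : 'I_m -> 'rV[int]_d -> R) :
  folding (@moment d) s -> tuple_bounded V r u ->
  (fun i => polarize (@moment d) s (u i)) <> u ->
  (tuple_potential V r (fun i => polarize (@moment d) s (u i)) <
   tuple_potential V r u)%N.
Proof.
move=> fold u_bd; set u' := fun i : 'I_m => _ => u'u.
have [i ui] : exists i, u' i <> u i.
  apply: contrapT => /forallNP h; apply: u'u; apply/funext => i.
  exact: contrapT (h i).
rewrite /tuple_potential (bigD1 i)//= [ltnRHS](bigD1 i)//=.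
rewrite -addSn leq_add ?potential_polarize//; apply: leq_sum => j _.
have [->//|uj] := pselect (u' j = u j).
by apply/ltnW/potential_polarize.
Qed.

(** Polarizing as long as some reflection changes the tuple terminates, because
    each change lowers the potential.  The predicate [Q] is an invariant carried
    along, later the lower bound on the Riesz sum. *)
Lemma exists_polarized (R : realType) (d m : nat) (e : 'rV[rat]_d) v w l
    (V : 'I_m -> seq R) (r : 'I_m -> nat)
    (Q : ('I_m -> 'rV[int]_d -> R) -> Prop) (u : 'I_m -> 'rV[int]_d -> R) :
  is_root e v w l ->
  (forall c u', tuple_bounded V r u' -> Q u' ->
     Q (fun i => polarize (@moment d) (reflection v w c) (u' i))) ->
  tuple_bounded V r u -> Q u ->
  exists u', [/\ tuple_bounded V r u', Q u',
    u' = u \/ (tuple_potential V r u' < tuple_potential V r u)%N,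
    (forall i c, polarize (@moment d) (reflection v w c) (u' i) = u' i) &
    (forall i, rearranged_along e (u i) (u' i))].
Proof.
move=> root Qpol.
have [n] := ubnP (tuple_potential V r u); elim: n u => // n IHn u un u_bd Qu.
have [[c uc]|/forallNP h] := pselect (exists c,
    (fun i => polarize (@moment d) (reflection v w c) (u i)) <> u); last first.
  exists u; split=> //; first by left.
  - move=> i c; have /contrapT := h c.
    exact: (congr1 (fun f => f i)).
  - by move=> i; exact: (rearranged_along_refl root).
have fold := reflection_folding root c.
have lt := tuple_potential_polarize fold u_bd uc.
have [|u' [u'_bd Qu' u'lt ufix ual]] := IHn _ (leq_trans lt un) _ (Qpol c u u_bd Qu).
  by move=> i; exact: polarize_bounded.
exists u'; split=> //.
  by right; case: u'lt => [->//|/ltn_trans]; apply.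
move=> i; apply: (rearranged_along_trans root) (ual i).
exact: (rearranged_along_polarize root).
Qed.

Section rearrange_tuple.
Variables (R : realType) (d m : nat) (G : 'rV[R]_m -> R).
Variable H : 'I_m -> 'I_m -> R -> R.
Hypothesis G_ge0 : forall y, orthant y -> 0 <= G y.
Hypothesis G_super : supermodular G.
Hypothesis H_ge0 : forall i j : 'I_m, (i < j)%N -> forall r : R, 0 <= r -> 0 <= H i j r.
Hypothesis H_mono : forall i j : 'I_m, (i < j)%N ->
  forall r r' : R, 0 <= r -> r <= r' -> H i j r' <= H i j r.
Variables (V : 'I_m -> seq R) (r : 'I_m -> nat).

Let improves (u u' : 'I_m -> 'rV[int]_d -> R) : Prop :=
  [/\ tuple_bounded V r u', (riesz_sum G H u <= riesz_sum G H u')%E &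
      u' = u \/ (tuple_potential V r u' < tuple_potential V r u)%N].

Lemma improves_trans u1 u2 u3 : improves u1 u2 -> improves u2 u3 -> improves u1 u3.
Proof.
move=> [_ J12 p12] [b3 J23 p23]; split=> //; first exact: le_trans J23.
case: p12 p23 => [->//|p12] [->|p23]; right=> //; exact: ltn_trans p12.
Qed.

Lemma improves_rearr_step (e : 'rV[rat]_d) u :
  directions e -> tuple_bounded V r u ->
  improves u (fun i => rearr_step e (u i)).
Proof.
move=> /directions_root[v [w [l root]]] u_bd.
have [|||u' [u'_bd Ju' u'lt ufix ual]] :=
    @exists_polarized R d m e v w l V r
      (fun u' => riesz_sum G H u <= riesz_sum G H u')%E u root.
- move=> c u' u'_bd Ju'; apply: le_trans Ju' _.
  apply: riesz_sum_polarize => //; first exact: (reflection_folding root).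
  by move=> i x; have [V0 uV _] := u'_bd i; exact: V0.
- exact: u_bd.
- exact: lexx.
have -> : (fun i => rearr_step e (u i)) = u'.
  by apply/funext => i; apply: (rearr_step_polarized root (ufix i)).
by split.
Qed.

(** The potentials of the iterates form a nonincreasing sequence of natural
    numbers.  Once it is constant no step changes the tuple any more. *)
Lemma rearr_iter_stable (E : seq 'rV[rat]_d) u :
  [set` E] `<=` @directions d -> (0 < size E)%N ->
  tuple_bounded V r u ->
  exists K, forall k, (K <= k)%N ->
    (forall i, rearr_iter E k (u i) = rearr_iter E K (u i)) /\
    (riesz_sum G H u <= riesz_sum G H (fun i => rearr_iter E K (u i)))%E.
Proof.
move=> Edir E0 u_bd; pose U k i := rearr_iter E k (u i).
have Ek k : directions (nth 0 E (k %% size E)).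
  by apply: Edir; rewrite /= mem_nth// ltn_mod.
have step k : improves u (U k) /\ improves (U k) (U k.+1).
  elim: k => [|k [IH1 IH2]].
    split; first by split=> //; left.
    exact: improves_rearr_step.
  have h := improves_trans IH1 IH2; split; first exact: h.
  by apply: improves_rearr_step => //; case: h.
have [K KP] : exists K, forall k, (K <= k)%N -> tuple_potential V r (U K) = tuple_potential V r (U k).
  have noninc k : (tuple_potential V r (U k.+1) <= tuple_potential V r (U k))%N.
    by have [_ [_ _ [->|/ltnW]]] := step k.
  have [K hK] : exists K, forall k, (tuple_potential V r (U K) <= tuple_potential V r (U k))%N.
    have ex : exists p, `[<exists k, tuple_potential V r (U k) = p>].
      by exists (tuple_potential V r (U 0%N)); apply/asboolP; exists 0%N.
    case: (ex_minnP ex) => p /asboolP[K Kp] pmin; exists K => k; rewrite Kp.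
    by apply: pmin; apply/asboolP; exists k.
  exists K => k Kk; apply/eqP; rewrite eqn_leq hK /=.
  rewrite -(subnK Kk); elim: (k - K)%N => // n IH.
  exact: leq_trans (noninc _) IH.
exists K => k Kk; split; last by have [[]] := step K.
suff UK : U k = U K by move=> i; exact: (congr1 (fun f => f i) UK).
elim: k Kk => [|k IH]; first by rewrite leqn0 => /eqP->.
rewrite leq_eqVlt => /predU1P[->//|Kk]; rewrite -IH//.
have [_ [_ _ [->//|]]] := step k.
by rewrite -!KP ?ltnn// ltnW.
Qed.

End rearrange_tuple.

(** * Truncation and limits *)

Definition cutoff (R : realType) (T : Type) (t : R) (u : T -> R) (x : T) : R :=
  if t < u x then u x else 0.

(** Above the level [t] both functions have the same superlevel sets.  If the value
    [a] is 0, then [w] exceeds [t] at fewer than [n] points, so its own n-th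
    largest value is at most [t]. *)
Lemma nth_largest_cutoff (R : realType) (T : Type) (D : set T) (w : T -> R)
    (n : nat) (t a : R) :
  0 < t -> (forall x, 0 <= w x) -> is_nth_largest D (cutoff t w) n a ->
  a = if t < nth_largest D w n then nth_largest D w n else 0.
Proof.
move=> t0 w0 a_nth; have [na an] := a_nth.
have t_cut x b : 0 <= b -> (b < cutoff t w x) = (t < w x) && (b < w x).
  by move=> b0; rewrite /cutoff; case: (t < w x); rewrite //= ltNge b0.
have t_cut' x b : 0 < b -> (b <= cutoff t w x) = (t < w x) && (b <= w x).
  by move=> b0; rewrite /cutoff; case: (t < w x); rewrite //= leNgt b0.
have [a0|a0|a0] := ltgtP a 0.
- case: na; apply: card_le_trans an _; apply: subset_card_le => x [Dx _].
  split=> //; apply: lt_le_trans a0 _; rewrite /cutoff.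
  by case: ifP.
- have ta : t < a.
    rewrite ltNge; apply/negP => at_; apply: na; apply: card_le_trans an _.
    apply: subset_card_le => x [Dx]; rewrite t_cut'// => /andP[tx _].
    by split=> //; rewrite t_cut ?ltW// tx (le_lt_trans at_).
  have a_nth' : is_nth_largest D w n a.
    split.
      move=> h; apply: na; apply: card_le_trans h _; apply: subset_card_le.
      by move=> x [Dx ax]; split=> //; rewrite t_cut ?ltW// ax (lt_trans ta).
    apply: card_le_trans an _; apply: subset_card_le => x [Dx].
    by rewrite t_cut'// => /andP[].
  by rewrite (nth_largestE a_nth') ta.
case: ifP => // tb; case: na; subst a.
move: tb; rewrite /nth_largest; case: xgetP => [b _ [_ nb] tb|_]; last first.
  by rewrite ltNge (ltW t0).
apply: card_le_trans nb _; apply: subset_card_le => x [Dx bx]; split=> //.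
by rewrite t_cut// (lt_le_trans tb bx) (lt_le_trans t0 (ltW (lt_le_trans tb bx))).
Qed.

Lemma cutoff_bounded (R : realType) (d : nat) (u : 'rV[int]_d -> R) (t : R) :
  admissible u -> 0 < t -> exists V r, bounded_in V r (cutoff t u).
Proof.
move=> [u0 ufin] t0; have /finite_seqP[s sE] := ufin t t0.
have tu x : t < u x -> x \in s.
  by move=> tx; have : [set x | t < u x] x by []; rewrite sE.
exists (0 :: map u s), (\max_(x <- s) moment x)%N; split.
- by move=> a; rewrite inE => /predU1P[->//|/mapP[x _ ->]].
- move=> x; rewrite /cutoff inE; case: ifP => [/tu xs|_]; last by rewrite eqxx.
  by rewrite map_f ?orbT.
- move=> x; rewrite /cutoff; case: ifP => // /tu xs.
  by rewrite ltnNge leq_bigmax_seq.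
Qed.

(** Truncation commutes with the one-step rearrangement.  The truncated function
    has finite support, so polarizations provide its rearrangement. *)
Lemma rearr_step_cutoff (R : realType) (d : nat) (e : 'rV[rat]_d)
    (u : 'rV[int]_d -> R) (t : R) :
  directions e -> admissible u -> 0 < t ->
  rearr_step e (cutoff t u) = cutoff t (rearr_step e u) /\
  exists V r, bounded_in V r (rearr_step e (cutoff t u)).
Proof.
move=> /directions_root[v [w [l root]]] uadm t0; have [u0 _] := uadm.
have [V [r u_bd]] := cutoff_bounded uadm t0.
have [||//|u' [u'_bd _ _ ufix ual]] :=
    @exists_polarized R d 1 e v w l (fun=> V) (fun=> r) (fun=> True)
      (fun=> cutoff t u) root.
- by [].
- by move=> i; exact: u_bd.
have stepE := rearr_step_polarized root (ufix ord0) (ual ord0).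
split; last by exists V, r; rewrite stepE; exact: u'_bd.
apply/funext => x; rewrite stepE.
apply: (nth_largest_cutoff t0 (w := u \o _)) => [y|]; first exact: u0.
exact: (polarized_rearr_line root x (ufix ord0) (ual ord0)).
Qed.

Lemma admissible_rearr_step (R : realType) (d : nat) (e : 'rV[rat]_d)
    (u : 'rV[int]_d -> R) :
  directions e -> admissible u -> admissible (rearr_step e u).
Proof.
move=> dir uadm; have [u0 _] := uadm; split=> [x|t t0].
  by apply: nth_largest_ge0 => s; exact: u0.
have [cutE [V [r]]] := rearr_step_cutoff dir uadm t0.
rewrite cutE => -[_ _ far]; apply: (@sub_finite_set _ _ [set` ball_seq d r]).
  move=> x /= tx; rewrite mem_ball_seq leqNgt; apply/negP => /far.
  by rewrite /cutoff tx => h; move: tx; rewrite h ltNge (ltW t0).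
exact: finite_seq.
Qed.

Lemma rearr_iter_cutoff (R : realType) (d : nat) (E : seq 'rV[rat]_d) (k : nat)
    (u : 'rV[int]_d -> R) (t : R) :
  [set` E] `<=` @directions d -> (0 < size E)%N -> admissible u -> 0 < t ->
  rearr_iter E k (cutoff t u) = cutoff t (rearr_iter E k u) /\
  admissible (rearr_iter E k u).
Proof.
move=> Edir E0 uadm t0; elim: k => [//|k [IH1 IH2]] /=.
have dir : directions (nth 0 E (k %% size E)).
  by apply: Edir; rewrite /= mem_nth// ltn_mod.
rewrite IH1; split; last exact: admissible_rearr_step.
by have [] := rearr_step_cutoff dir IH2 t0.
Qed.

(** A divergent sequence has the default value 0 as its limit. *)
Lemma limn_ge0 (R : realType) (f : nat -> R) :
  (forall k, 0 <= f k) -> 0 <= limn f.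
Proof.
move=> f0; have [c|/dvgP->//] := pselect (cvgn f).
by apply: limr_ge => //; exact: nearW.
Qed.

Lemma limn_eventually (R : realType) (f : nat -> R) K c :
  (forall k, (K <= k)%N -> f k = c) -> limn f = c.
Proof. by move=> fc; apply: lim_near_cst => //; exists K => // k /= /fc. Qed.

(** For the truncated tuple the iterates are eventually equal to a tuple [f].
    Where [f i] does not vanish, the untruncated iterates have the same constant
    value eventually, which is then the limit.  So [f] arises from the limits by
    replacing some coordinates by 0, and this does not increase [G]. *)
Lemma schwarz_cutoff_le (R : realType) (d m : nat) (E : seq 'rV[rat]_d)
    (u : 'I_m -> 'rV[int]_d -> R) (G : 'rV[R]_m -> R)
    (H : 'I_m -> 'I_m -> R -> R) (t : R) :
  [set` E] `<=` @directions d -> (0 < size E)%N ->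
  (forall i, admissible (u i)) ->
  (forall y, orthant y -> 0 <= G y) -> supermodular G -> G 0 = 0 ->
  (forall i j : 'I_m, (i < j)%N -> forall r : R, 0 <= r -> 0 <= H i j r) ->
  (forall i j : 'I_m, (i < j)%N ->
       forall r s : R, 0 <= r -> r <= s -> H i j s <= H i j r) ->
  0 < t ->
  (riesz_sum G H (fun i => cutoff t (u i)) <=
   riesz_sum G H (fun i => schwarz E (u i)))%E.
Proof.
move=> Edir E0 uadm G0 Gs G00 H0 Hm t0.
have [V VP] := choice (fun i => cutoff_bounded (uadm i) t0).
have [r u_bd] := choice VP.
have [K KP] := rearr_iter_stable G0 Gs H0 Hm Edir E0 u_bd.
have [_ J] := KP K (leqnn K); apply: le_trans J _.
apply: le_esum => x _; rewrite lee_fin; apply: ler_wpM2r.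
  by apply: prodr_ge0 => i _; apply: prodr_ge0 => j ij; exact: H0.
pose f i y := rearr_iter E K (cutoff t (u i)) y.
pose y : 'rV[R]_m := \row_i schwarz E (u i) (x i).
have y0 : orthant y.
  move=> i; rewrite mxE; apply: limn_ge0 => k.
  by have [_ [+ _]] := rearr_iter_cutoff k Edir E0 (uadm i) t0; exact.
have := supermodular_restrict_le [set i | f i (x i) != 0]%SET Gs G0 G00 y0.
congr (_ <= _); congr G; apply/rowP => i; rewrite !mxE finset.inE.
case: eqP => //= fx; apply: limn_eventually => k Kk.
have [/(_ i) fk _] := KP k Kk.
have [cutE _] := rearr_iter_cutoff k Edir E0 (uadm i) t0.
rewrite -/(f i (x i)); move: fx; rewrite /f -fk cutE /cutoff.
by case: ifP.
Qed.

Lemma exists_below (R : realType) (L : seq R) :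
  exists2 t, 0 < t & forall a, a \in L -> 0 < a -> t < a.
Proof.
elim: L => [|b L [t t0 tL]]; first by exists 1.
have [b0|b0] := ltP 0 b; last first.
  exists t => // a; rewrite inE => /predU1P[->|/tL//].
  by rewrite ltNge b0.
exists (Num.min t (b / 2)); first by rewrite lt_min t0 divr_gt0.
move=> a; rewrite inE => /predU1P[-> _|aL a0]; rewrite gt_min.
  by rewrite ltr_pdivrMr// ltr_pMr ?ltr1n ?orbT.
by rewrite tL.
Qed.

Theorem theorem5p10 (R : realType) (d m : nat) (hd : (1 <= d)%N) (hm : (2 <= m)%N)
    (E : seq 'rV[rat]_d) (hE : enumerates_directions E)
    (u : 'I_m -> 'rV[int]_d -> R) (hu : forall i, admissible (u i))
    (G : 'rV[R]_m -> R)
    (hGmeas : borel_on_orthant G)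
    (hGge0 : forall y, orthant y -> 0 <= G y)
    (hGsuper : supermodular G)
    (hG0 : G 0 = 0)
    (H : 'I_m -> 'I_m -> R -> R)
    (hHge0 : forall i j : 'I_m, (i < j)%N -> forall r : R, 0 <= r -> 0 <= H i j r)
    (hHmono : forall i j : 'I_m, (i < j)%N ->
       forall r s : R, 0 <= r -> r <= s -> H i j s <= H i j r) :
  (riesz_sum G H u <= riesz_sum G H (fun i => schwarz E (u i)))%E.
Proof.
have [_ Eset] := hE.
have Edir : [set` E] `<=` @directions d by rewrite Eset.
have E0 : (0 < size E)%N.
  have : [set` E] (unit_vec (Ordinal hd)) by rewrite Eset; left; eexists.
  by case: (E).
(* A finite partial sum meets only finitely many values of the functions, so it
   is not affected by truncation at a small enough level. *)
apply: ub_ereal_sup => _ [A [Afin _] <-].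
have /finite_seqP[s sE] := Afin.
have [t t0 tL] := exists_below
  [seq u i (x i) | x : {ffun 'I_m -> 'rV[int]_d} <- s, i <- enum 'I_m].
apply: le_trans (schwarz_cutoff_le Edir E0 hu hGge0 hGsuper hG0 hHge0 hHmono t0).
apply: esum_ge; exists A; first by split.
rewrite le_eqVlt; apply/orP; left; apply/eqP; apply: eq_fsbigr => x xA; congr (G _ * _)%:E.
apply/rowP => i; rewrite !mxE /cutoff; case: ifP => // /negP ntx.
have [u0 _] := hu i; apply/eqP; rewrite eq_le u0 andbT leNgt.
apply/negP => ux; apply/ntx/tL => //; apply/allpairsP; exists (x, i).
by split=> //=; [move: xA; rewrite sE inE|rewrite mem_enum].
Qed.
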